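(* Let $n,r$ be positive integers. In all cases, regular as well as singular, every non-trivial block of the block diagonal form of $H_D$ is of the form $\begin{pmatrix}0&1\\-1&0\end{pmatrix}$.
   Context: $N_r$ is the $r\times r$ matrix with all entries on and above the diagonal equal to $-1$ and zeros below the diagonal; $M_r=-N_r^t$. $H_D$ is the $nr\times nr$ integer skew-symmetric matrix consisting of $n\times n$ blocks of size $r\times r$ with diagonal blocks $0$, all blocks above the diagonal equal to $M_r$ and all blocks below the diagonal equal to $N_r$. A block diagonal form of a skew-symmetric integer matrix $J$ of size $N$ and corank $c$ is a matrix $L^tJL=\operatorname{Diag}(D_1,\dots,D_k,0,\dots,0)$, with $L$ an integer matrix of determinant $\pm1$, $k=\tfrac12(N-c)$, and each $D_i=\begin{pmatrix}0&h_i\\-h_i&0\end{pmatrix}$ nonzero (a ''non-trivial block''); blocks are considered up to the sign of $h_i$. *)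

(* Defs.v *)
From HB Require Import structures.
From mathcomp Require Import all_boot all_order all_algebra.

Set Implicit Arguments.
Unset Strict Implicit.
Unset Printing Implicit Defensive.

Import GRing.Theory.

Local Open Scope ring_scope.

Definition Nmx (r : nat) : 'M[int]_r :=
  \matrix_(i < r, j < r) (if (i <= j)%N then -1 else 0).

Definition Mmx (r : nat) : 'M[int]_r := - (Nmx r)^T.

(* The size \sum_(i < n) r, equal to n * r, is the one computed by \mxblock. *)
Definition HD (n r : nat) : 'M[int]_(\sum_(i < n) r) :=
  \mxblock_(i < n, j < n)
    (if (i < j)%N then Mmx r else if (j < i)%N then Nmx r else 0).

Definition corank (N : nat) (J : 'M[int]_N) : nat :=
  (N - \rank (map_mx intr J : 'M[rat]_N))%N.

Definition skew_block (h : int) : 'M[int]_2 :=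
  block_mx (0 : 'M_1) h%:M (- h)%:M (0 : 'M_1).

(* The equation eN says 2 * k + corank J = N, that is k = (N - corank J) / 2. *)
Definition is_block_diagonal_form (N : nat) (J : 'M[int]_N)
    (L : 'M[int]_N) (k : nat) (h : 'I_k -> int) : Prop :=
  [/\ \det L = 1 \/ \det L = -1,
      forall i, h i != 0
    & exists eN : (\sum_(i < k) 2 + corank J)%N = N,
        L^T *m J *m L =
          castmx (eN, eN) (block_mx (\mxdiag_(i < k) skew_block (h i)) 0 0 0)].

(* Main.v *)
(**
  Over [int] a skew-symmetric matrix has a block diagonal form, obtained by
  Euclid's algorithm on a pivot.  Its nonzero blocks are all units if and only
  if the row lattice is saturated, i.e. closed under division by nonzero
  integers whenever the quotient is an integer vector.

  For [HD] with [n] blocks of size [r], send the basis vector in position [b]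
  of block [j] (both counted from 0) to the monomial [X^(j + (r - 1 - b))].
  With [m]_X = 1 + X + ... + X^(m-1), a vector lies in the row lattice if and
  only if its image is in the ideal ([n-1]_X, [r+1]_X) of Z[X].  This ideal is
  generated by the monic polynomial [g]_X, where g = gcd(n-1, r+1), so it is
  closed under division by nonzero integers.
*)
Require Import Defs.
From mathcomp Require Import all_boot all_order all_algebra fingroup perm.
From mathcomp Require Import ring zify.

Set Implicit Arguments.
Unset Strict Implicit.
Unset Printing Implicit Defensive.

Import Order.TTheory GRing.Theory Num.Theory.

Local Open Scope ring_scope.

(** * Elementary blocks and congruence of skew-symmetric matrices *)

Lemma skew_block_entries (h : int) (A : 'M[int]_2) :
  A 0 0 = 0 -> A 0 1 = h -> A 1 0 = - h -> A 1 1 = 0 -> A = skew_block h.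
Proof.
move=> A00 A01 A10 A11.
have lO : lshift 1 (0 : 'I_1) = 0 :> 'I_2 by apply/val_inj.
have rO : rshift 1 (0 : 'I_1) = 1 :> 'I_2 by apply/val_inj.
rewrite -[A](@submxK _ 1 1 1 1) /skew_block.
by congr (@block_mx _ 1 1 1 1 _ _ _ _); apply/matrixP=> i j;
  rewrite !ord1 !mxE ?lO ?rO.
Qed.

Lemma skew_blockE (h : int) :
  [/\ skew_block h 0 0 = 0, skew_block h 0 1 = h,
      skew_block h 1 0 = - h & skew_block h 1 1 = 0].
Proof.
have lO : 0 = lshift 1 (0 : 'I_1) :> 'I_2 by apply/val_inj.
have rO : 1 = rshift 1 (0 : 'I_1) :> 'I_2 by apply/val_inj.
split; rewrite ?lO ?rO.
- by rewrite [LHS](@block_mxEul _ 1 1 1 1) mxE.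
- by rewrite [LHS](@block_mxEur _ 1 1 1 1) mxE.
- by rewrite [LHS](@block_mxEdl _ 1 1 1 1) mxE.
- by rewrite [LHS](@block_mxEdr _ 1 1 1 1) mxE.
Qed.

Lemma tr_skew_block (h : int) : (skew_block h)^T = - skew_block h.
Proof.
rewrite [LHS](@tr_block_mx _ 1 1 1 1) [RHS](@opp_block_mx _ 1 1 1 1).
by congr (@block_mx _ 1 1 1 1 _ _ _ _); apply/matrixP=> i j;
  rewrite !ord1 !mxE ?oppr0 ?mulr1n ?opprK.
Qed.

Lemma skew_diag0 N (J : 'M[int]_N) i : J^T = - J -> J i i = 0.
Proof. by move=> /matrixP/(_ i i); rewrite !mxE; move: (J i i) => x; lia. Qed.

Lemma skew_congr N (J L : 'M[int]_N) : J^T = - J ->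
  (L^T *m J *m L)^T = - (L^T *m J *m L).
Proof.
by move=> skJ; rewrite !trmx_mul trmxK skJ mulNmx mulmxN mulmxA.
Qed.

Lemma add_delta_unit N (q : int) (j k : 'I_N) :
  j != k -> 1%:M + q *: delta_mx j k \in unitmx.
Proof.
move=> njk.
suff /mulmx1_unit[] : (1%:M + q *: delta_mx j k) *m (1%:M - q *: delta_mx j k)
    = 1%:M by [].
rewrite mulmxDl mul1mx mulmxBr mulmx1 -scalemxAl -scalemxAr mul_delta_mx_0.
  by rewrite !scaler0 subr0 subrK.
by rewrite eq_sym.
Qed.

(* Euclid's algorithm on the pivot [J i j]: a column operation replaces an
   entry of row [i] or [j] by its remainder modulo the pivot. *)
Lemma pivot_dvd N (J : 'M[int]_N) (i j : 'I_N) : J^T = - J -> J i j != 0 ->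
  exists L : 'M[int]_N, exists i', exists j',
  let A := L^T *m J *m L in
  [/\ L \in unitmx, A i' j' != 0
    & forall k, (A i' j' %| A i' k)%Z && (A i' j' %| A j' k)%Z].
Proof.
move: {2}(absz (J i j)).+1 (ltnSn (absz (J i j))) => b.
elim: b => // b IHb in J i j * => ltb skJ nz.
(* Stated for any entry as large as the pivot in absolute value, so that it serves both [J i j] and
   its mirror [J j i]. *)
have step (u v k : 'I_N) : `|J u v|%N = `|J i j|%N -> ~~ (J u v %| J u k)%Z ->
  exists L : 'M[int]_N, exists i', exists j',
  let A := L^T *m J *m L in
  [/\ L \in unitmx, A i' j' != 0
    & forall k, (A i' j' %| A i' k)%Z && (A i' j' %| A j' k)%Z].
  move=> euv nd; have nzuv : J u v != 0 by lia.
  have nvk : v != k by apply: contraNneq nd => <-; apply: dvdzz.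
  have nuk : u != k.
    by apply: contraNneq nd => <-; rewrite (skew_diag0 _ skJ) dvdz0.
  pose q := (J u k %/ J u v)%Z.
  (* Congruence by [E] subtracts [q] times column [v] from column [k], then does the same to the
     rows. Since [u != k], row [u] feels only the column operation. *)
  pose E : 'M[int]_N := 1%:M + (- q) *: delta_mx v k.
  pose J1 := E^T *m J *m E.
  have J1uk : J1 u k = (J u k %% J u v)%Z.
    have ET : E^T = 1%:M + (- q) *: delta_mx k v.
      by rewrite [LHS]linearD /= trmx1 linearZ /= trmx_delta.
    rewrite /J1 ET /E.
    rewrite mulmxDl mul1mx mulmxDr mulmx1 -!scalemxAl -!scalemxAr.
    have row0 (B : 'M[int]_N) : (delta_mx k v *m B) u k = 0.
      by rewrite !mxE big1 // => t _; rewrite !mxE (negPf nuk) mul0r.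
    have col1 : (J *m delta_mx v k) u k = J u v.
      rewrite mxE (bigD1 v) //= big1 ?addr0; first by rewrite !mxE !eqxx mulr1.
      by move=> t /negPf ntv; rewrite !mxE ntv mulr0.
    rewrite mulmxDl -scalemxAl -mulmxA !mxE.
    have := row0 J; have := row0 (J *m delta_mx v k); have := col1.
    rewrite !mxE => -> -> ->.
    by rewrite /q /modz; ring.
  have E_unit : E \in unitmx by apply: add_delta_unit.
  have nz1 : J1 u k != 0 by rewrite J1uk; apply: contra nd => /eqP/dvdz_mod0P.
  have lt1 : (absz (J1 u k) < b)%N.
    have h1 := modz_ge0 (J u k) nzuv; have h2 := ltz_mod (J u k) nzuv.
    rewrite J1uk; lia.
  have [L [i' [j' [Lu nzA dv]]]] := IHb J1 u k lt1 (skew_congr E skJ) nz1.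
  exists (E *m L), i', j'; rewrite unitmx_mul E_unit Lu trmx_mul.
  by rewrite -!mulmxA; move: nzA dv; rewrite /J1 -!mulmxA.
have [/forallP dvi|/forallPn[k ndk]] :=
    boolP [forall k, (J i j %| J i k)%Z && (J i j %| J j k)%Z].
  by exists 1%:M, i, j; rewrite unitmx1 trmx1 mul1mx mulmx1; split.
have Jji : J j i = - J i j by move/matrixP: skJ => /(_ i j); rewrite !mxE.
case/nandP: ndk => ndk; first exact: step ndk.
by apply: (step j i k); rewrite ?Jji ?abszN // !dvdzE ?abszN in ndk *.
Qed.

Lemma perm_pair N (i j : 'I_N.+2) : i != j ->
  exists s : 'S_N.+2, s 0 = i /\ s 1 = j.
Proof.
move=> nij; pose z : 'I_N.+2 := 0; pose u : 'I_N.+2 := 1.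
pose s1 := tperm z i; pose s2 := tperm u (s1 j).
have s1j : s1 j != z by rewrite -[z](tpermR z i) (inj_eq perm_inj) eq_sym.
(* [s1] alone sends 0 to [i]. Applying [s2] first adjusts the image of 1 and keeps 0 fixed, because
   [s1 j] is not 0. *)
exists (s2 * s1)%g; rewrite -/z -/u !permM.
have -> : s2 z = z by rewrite tpermD.
by rewrite tpermL tpermL tpermK.
Qed.

(** The pivot, moved to position (0, 1), divides the first two rows. The equation
    [skew_block h *m X = - B] is then solvable over the integers, and a unitriangular congruence
    built from [X] clears the off-diagonal blocks, leaving a Schur complement. *)
Lemma skew_split m (J : 'M[int]_(2 + m)) : J^T = - J -> J != 0 ->
  exists L : 'M[int]_(2 + m), exists h : int, exists A : 'M[int]_m,
  [/\ L \in unitmx, h != 0, A^T = - A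
    & L^T *m J *m L = block_mx (skew_block h) 0 0 A].
Proof.
move=> skJ nzJ.
have /existsP[i /existsP[j nz]] : [exists i, exists j, J i j != 0].
  apply: contraR nzJ => /existsPn all0; apply/eqP/matrixP=> i j.
  by have /existsPn/(_ j) := all0 i; rewrite negbK mxE => /eqP.
have [L1 [i1 [j1 [L1u nz1 dv1]]]] := pivot_dvd skJ nz.
have sk1 := skew_congr L1 skJ; move: sk1 nz1 dv1.
set J1 := L1^T *m J *m L1 => sk1 nz1 dv1.
have nij : i1 != j1.
  by apply: contraNneq nz1 => <-; rewrite (skew_diag0 _ sk1).
have [s [s0 s1]] := perm_pair nij.
pose P : 'M[int]_(2 + m) := (perm_mx s)^T.
have Pu : P \in unitmx by rewrite unitmx_tr unitmx_perm.
pose J2 := P^T *m J1 *m P.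
have J2E u v : J2 u v = J1 (s u) (s v).
  rewrite /J2 /P trmxK -row_permE -[_^T]trmxK trmxK tr_perm_mx -col_permE.
  by rewrite !mxE.
have sk2 : J2^T = - J2 by apply: skew_congr.
pose h := J1 i1 j1.
pose B : 'M[int]_(2, m) := ursubmx J2.
pose D : 'M[int]_m := drsubmx J2.
have J2B : J2 = block_mx (skew_block h) B (- B^T) D.
  rewrite -[J2]submxK -/B -/D; congr block_mx.
    have l0 : lshift m (0 : 'I_2) = 0 by apply/val_inj.
    have l1 : lshift m (1 : 'I_2) = 1 by apply/val_inj.
    apply: skew_block_entries.
    - by rewrite 2!mxE l0 skew_diag0.
    - by rewrite 2!mxE l0 l1 J2E s0 s1.
    - rewrite 2!mxE l0 l1; have /matrixP/(_ 0 1) := sk2.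
      by rewrite mxE [RHS]mxE => ->; rewrite J2E s0 s1.
    - by rewrite 2!mxE l1 skew_diag0.
  by rewrite /B trmx_ursub sk2; apply/matrixP=> u v; rewrite !mxE opprK.
have dvB0 v : (h %| B 0%R v)%Z.
  have -> : B 0 v = J1 i1 (s (rshift 2 v)).
    by rewrite 2!mxE J2E -s0; congr (J1 (s _) _); apply/val_inj.
  by case/andP: (dv1 (s (rshift 2 v))).
have dvB1 v : (h %| B 1%R v)%Z.
  have -> : B 1 v = J1 j1 (s (rshift 2 v)).
    by rewrite 2!mxE J2E -s1; congr (J1 (s _) _); apply/val_inj.
  by case/andP: (dv1 (s (rshift 2 v))).
clearbody B D.
(* This is minus the inverse of the block times [B]: the inverse swaps the two rows and divides by
   [h] up to sign. *)
pose X : 'M[int]_(2, m) := \matrix_(u, v)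
  if (u : 'I_2) == 0 then (B 1%R v %/ h)%Z else (- (B 0%R v %/ h)%Z).
have SX : skew_block h *m X = - B.
  have [S00 S01 S10 S11] := skew_blockE h.
  apply/matrixP=> u v; rewrite 2!mxE !big_ord_recl big_ord0 addr0.
  have -> : lift ord0 ord0 = 1 :> 'I_2 by apply/val_inj.
  have -> : ord0 = 0 :> 'I_2 by apply/val_inj.
  have [-> ->] : X 0 v = (B 1%R v %/ h)%Z /\ X 1 v = - (B 0%R v %/ h)%Z.
    by rewrite !mxE.
  have [->|->] : u = 0 \/ u = 1.
    by case: u => [[|[|[]]]] // ?; [left | right]; apply/val_inj.
    by rewrite S00 S01 mul0r add0r mulrN mulrC divzK.
  by rewrite S10 S11 mul0r addr0 mulNr mulrC divzK.
pose E := block_mx 1%:M X 0 1%:M : 'M[int]_(2 + m).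
have Eu : E \in unitmx by rewrite unitmxE det_ublock !det1 mulr1 unitr1.
have XS : X^T *m skew_block h = B^T.
  by apply: trmx_inj; rewrite trmx_mul !trmxK tr_skew_block mulNmx SX opprK.
have EJE : E^T *m J2 *m E = block_mx (skew_block h) 0 0 (X^T *m B + D).
  rewrite J2B /E tr_block_mx !trmx1 trmx0 !mulmx_block.
  rewrite !mul1mx !mul0mx !mulmx1 !mulmx0 !addr0 XS SX addNr subrr mul0mx.
  by rewrite add0r.
exists (L1 *m P *m E), h, (X^T *m B + D); split=> //.
- by rewrite !unitmx_mul L1u Pu.
- have := skew_congr E sk2; rewrite EJE tr_block_mx opp_block_mx.
  by case/eq_block_mx.
- by rewrite !trmx_mul -EJE /J2 /J1 !mulmxA.
Qed.

(** * Existence of the block diagonal form, by induction on the size *)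

Lemma block_diag_congr (R : comPzRingType) m1 m2
    (S : 'M[R]_m1) (A L : 'M[R]_m2) :
  (block_mx 1%:M 0 0 L)^T *m block_mx S 0 0 A *m block_mx 1%:M 0 0 L
  = block_mx S 0 0 (L^T *m A *m L).
Proof.
rewrite tr_block_mx trmx1 !trmx0 !mulmx_block.
by rewrite !(mul1mx, mul0mx, mulmx1, mulmx0, addr0, add0r).
Qed.

(** Absorbs a new leading block into the diagonal part, the zero part staying last; the casts only
    reassociate the sizes. *)
Lemma block_diag_zeroA (V : nmodType) m1 m2 m3 (A : 'M[V]_m1) (B : 'M[V]_m2) :
  block_mx A 0 0 (block_mx B 0 0 (0 : 'M_m3)) =
  castmx (esym (addnA m1 m2 m3), esym (addnA m1 m2 m3))
    (block_mx (block_mx A 0 0 B) 0 0 0).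
Proof.
have := @block_mxA V m1 m2 m3 m1 m2 m3 A 0 0 0 B 0 0 0 0.
by rewrite !row_mx0 !col_mx0.
Qed.

(* [c] is left free here; [skew_form_corank] identifies it with the corank. *)
Definition skew_form N (J L : 'M[int]_N) k c (h : 'I_k -> int) : Prop :=
  [/\ L \in unitmx, forall i, h i != 0
    & exists e : (\sum_(i < k) 2 + c = N)%N, L^T *m J *m L =
      castmx (e, e) (block_mx (\mxdiag_(i < k) skew_block (h i)) 0 0 0)].

Lemma skew_form_extend m (J L0 : 'M[int]_(2 + m)) (A L1 : 'M[int]_m) h0 k c
    (h : 'I_k -> int) :
  L0 \in unitmx -> h0 != 0 ->
  L0^T *m J *m L0 = block_mx (skew_block h0) 0 0 A ->
  skew_form A L1 c h ->
  skew_form J (L0 *m block_mx 1%:M 0 0 L1) c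
    (fun i : 'I_k.+1 => if unlift ord0 i is Some i' then h i' else h0).
Proof.
move=> L0u nzh0 L0E [L1u nzh [e L1E]]; subst m; rewrite castmx_id in L1E.
split; first by rewrite unitmx_mul L0u unitmxE det_ublock det1 mul1r.
  by move=> i; case: unliftP.
have e' : (\sum_(i < k.+1) 2 + c = 2 + (\sum_(i < k) 2 + c))%N.
  by rewrite big_ord_recl addnA.
exists e'; rewrite trmx_mul -!mulmxA (mulmxA L0^T) (mulmxA (L0^T *m J)) L0E.
rewrite mulmxA block_diag_congr L1E mxdiag_recl unlift_none.
rewrite [in RHS](@eq_mxdiag _ _ _ _ (fun i => skew_block (h i))); last first.
  by move=> i; rewrite liftK.
move: e'; case: _ / mxsize_recl => e'; rewrite castmx_id.
by rewrite block_diag_zeroA; apply: eq_castmx.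
Qed.

Lemma skew_normal_form N (J : 'M[int]_N) : J^T = - J ->
  exists L : 'M[int]_N, exists k c : nat, exists h : 'I_k -> int,
  skew_form J L c h.
Proof.
move: {2}N.+1 (ltnSn N) => b; elim: b => // b IHb in N J * => ltN skJ.
have [J0|nzJ] := eqVneq J 0.
  exists 1%:M, 0%N, N, (fun=> 1); split=> //; first exact: unitmx1.
  have e : (\sum_(i < 0) 2 + N = N)%N by rewrite big_ord0.
  exists e; have -> : \mxdiag_(i < 0) skew_block 1 = 0.
    by apply/matrixP=> u; case: (tagnat.sig1 u).
  rewrite block_mx0 J0 mulmx0 mul0mx.
  by apply/matrixP=> i j; rewrite castmxE !mxE.
case: N => [|[|m]] in J ltN skJ nzJ *.
- by case/eqP: nzJ; apply/matrixP; case.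
- case/eqP: nzJ; apply/matrixP=> i j.
  by rewrite !ord1 skew_diag0 ?mxE.
have [L0 [h0 [A [L0u nzh0 skA L0E]]]] := @skew_split m J skJ nzJ.
have [L1 [k [c [h L1E]]]] := IHb m A (ltnW ltN) skA.
by do 4!eexists; apply: (@skew_form_extend m) L1E; eassumption.
Qed.

Lemma rank_skew_block (h : int) : h != 0 ->
  \rank (map_mx intr (skew_block h) : 'M[rat]_2) = 2%N.
Proof.
move=> nzh; apply/eqP; rewrite -/(row_free _) row_free_unit unitmxE unitfE.
have [S00 S01 S10 S11] := skew_blockE h.
rewrite det_map_mx intr_eq0 (expand_det_row _ 0) !big_ord_recl big_ord0 addr0.
have -> : lift ord0 ord0 = 1 :> 'I_2 by apply/val_inj.
rewrite S00 mul0r add0r S01 /cofactor det_mx11 2!mxE.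
have -> : lift 1 0 = 0 :> 'I_2 by apply/val_inj.
have -> : lift 0 0 = 1 :> 'I_2 by apply/val_inj.
by rewrite S10 mulN1r opprK mulf_neq0.
Qed.

(** Invertible congruence preserves the rank over the rationals, and each nonzero block contributes
    2 to it. *)
Lemma skew_form_corank N (J L : 'M[int]_N) k c (h : 'I_k -> int) :
  skew_form J L c h -> c = corank J.
Proof.
move=> [Lu nzh [e LE]].
have Lq : map_mx intr L \in @unitmx rat N.
  by rewrite unitmxE det_map_mx rmorph_unit.
have : \rank (map_mx intr (L^T *m J *m L) : 'M[rat]_N) = (\sum_(i < k) 2)%N.
  rewrite LE; subst N; rewrite castmx_id map_block_mx !map_mx0.
  rewrite rank_diag_block_mx mxrank0 addn0.
  have -> : map_mx intr (\mxdiag_(i < k) skew_block (h i)) =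
      \mxdiag_(i < k) (map_mx intr (skew_block (h i)) : 'M[rat]_2).
    apply/matrixP=> i j; rewrite mxE /mxdiag /mxblock [in LHS]mxE [RHS]mxE.
    by case: eqVneq => _; rewrite ?conform_mx_id mxE // !mxE.
  by rewrite rank_mxdiag; apply: eq_bigr => i _; apply: rank_skew_block.
rewrite !map_mxM -map_trmx mxrankMfree ?row_free_unit //.
rewrite -mxrank_tr trmx_mul trmxK mxrankMfree ?row_free_unit // mxrank_tr.
by rewrite /corank => ->; rewrite -[in LHS](addKn (\sum_(i < k) 2)%N c) e.
Qed.

Lemma skew_form_exists N (J : 'M[int]_N) : J^T = - J ->
  exists L : 'M[int]_N, exists k : nat, exists h : 'I_k -> int,
  is_block_diagonal_form J L h.
Proof.
move=> /skew_normal_form[L [k [c [h Lh]]]]; exists L, k, h.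
have ec := skew_form_corank Lh; case: Lh => Lu nzh; rewrite {}ec => Le.
split=> //; move: Lu; rewrite unitmxE => /orP[]/eqP; auto.
Qed.

(** * Saturated row lattices and unit blocks *)

Definition saturated N (J : 'M[int]_N) := forall (d : int) (v w : 'rV[int]_N),
  d != 0 -> d *: v = w *m J -> exists w', v = w' *m J.

(** The factor [L] acts as an automorphism of the ambient lattice, while [L^T] only changes the
    coefficients of the combinations. *)
Lemma saturated_congr N (J L : 'M[int]_N) : L \in unitmx ->
  saturated J -> saturated (L^T *m J *m L).
Proof.
move=> Lu satJ d v w nzd dv.
have [w' w'E] : exists w', v *m invmx L = w' *m J.
  apply: (satJ d _ (w *m L^T)) => //.
  by rewrite scalemxAl dv -!mulmxA mulmxV // mulmx1.
exists (w' *m invmx L^T); rewrite !mulmxA mulmxKV ?unitmx_tr //.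
by rewrite -w'E mulmxKV.
Qed.

(** Row [s] is [d] times the basis vector at [t], so saturation puts that basis vector itself in the
    row lattice. Column [t] meets only row [s], and comparing coordinates at [t] gives an inverse of
    [d]. *)
Lemma saturated_entry_unit N (D : 'M[int]_N) (d : int) (s t : 'I_N) :
  saturated D -> d != 0 -> (forall i, D i t = d *+ (i == s)) ->
  (forall j, D s j = d *+ (j == t)) -> d \is a GRing.unit.
Proof.
move=> satD nzd colD rowD.
have [|w wE] := satD d (delta_mx 0 t) (delta_mx 0 s) nzd.
  rewrite -rowE; apply/matrixP=> i j.
  by rewrite !mxE rowD !ord1 eqxx mulr_natr.
have /matrixP/(_ 0 t) := wE; rewrite !mxE !eqxx (bigD1 s) //= big1 => [|i].
  by rewrite addr0 colD eqxx => e; apply/unitrPr; exists (w 0 s); rewrite mulrC.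
by move=> /negPf ns; rewrite colD ns mulr0.
Qed.

Lemma eq_Rank_const k p (u v : 'I_k) (a b : 'I_p) :
  (@tagnat.Rank k (fun=> p) u a == @tagnat.Rank k (fun=> p) v b)
  = (u == v) && (a == b).
Proof. exact: (@tagnat.eq_Rank k (fun=> p)). Qed.

Lemma mxdiag_RankE (V : nmodType) k p (B : 'I_k -> 'M[V]_p) u v a b :
  (\mxdiag_(i < k) B i) (@tagnat.Rank k (fun=> p) u a)
    (@tagnat.Rank k (fun=> p) v b) = if u == v then B u a b else 0.
Proof.
rewrite /mxdiag /mxblock mxE !tagnat.Rank2K !cast_ord_id !tagnat.Rank1K.
by case: eqP => _; rewrite ?conform_mx_id // mxE.
Qed.

Lemma ord2_cases (P : 'I_2 -> Prop) : P 0 -> P 1 -> forall u, P u.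
Proof.
by move=> P0 P1 [[|[|[]]] // lt]; [move: P0 | move: P1];
  congr (P _); apply/val_inj.
Qed.

Lemma saturated_skew_form_unit N (J L : 'M[int]_N) k (h : 'I_k -> int) i :
  saturated J -> is_block_diagonal_form J L h -> h i \is a GRing.unit.
Proof.
move=> satJ [detL nzh]; move: (corank J) => c [e LE].
have Lu : L \in unitmx by rewrite unitmxE; case: detL => ->.
move: (saturated_congr Lu satJ); rewrite {}LE {satJ detL Lu L J}.
subst N; rewrite castmx_id => satD.
have [S00 S01 S10 S11] := skew_blockE (h i).
(* The two coordinates of block [i]; the entry at ([p 0], [p 1]) is [h i], alone in its row and its
   column. *)
pose p (a : 'I_2) := lshift c (@tagnat.Rank k (fun=> 2%N) i a).
apply: (@saturated_entry_unit _ _ _ (p 0) (p 1) satD (nzh i)).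
- move=> s; case: (split_ordP s) => [s' ->|s' ->]; last first.
    by rewrite /p block_mxEdl mxE eq_rlshift.
  rewrite /p block_mxEul eq_lshift -[s']tagnat.sig2K mxdiag_RankE eq_Rank_const.
  case: eqVneq => //= eu; move: (tagnat.sig2 s'); rewrite eu.
  by apply: ord2_cases; rewrite ?S01 ?S11.
- move=> s; case: (split_ordP s) => [s' ->|s' ->]; last first.
    by rewrite /p block_mxEur mxE eq_rlshift.
  rewrite /p block_mxEul eq_lshift -[s']tagnat.sig2K mxdiag_RankE eq_Rank_const.
  rewrite eq_sym; case: eqVneq => //= eu; move: (tagnat.sig2 s').
  by apply: ord2_cases; rewrite ?S00 ?S01.
Qed.

(** * The polynomials 1 + X + ... + X^(m-1) and division by monic polynomials *)

Definition geom (m : nat) : {poly int} := \sum_(i < m) 'X^i.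

Lemma geom_poly m : geom m = \poly_(i < m) 1.
Proof. by rewrite poly_def; apply: eq_bigr => i _; rewrite scale1r. Qed.

Lemma size_geom m : size (geom m) = m.
Proof.
case: m => [|m]; first by rewrite /geom big_ord0 size_poly0.
by rewrite geom_poly size_poly_eq ?oner_neq0.
Qed.

Lemma geom_monic m : (0 < m)%N -> geom m \is monic.
Proof.
by case: m => // m _; rewrite monicE geom_poly lead_coef_poly ?oner_neq0.
Qed.

Lemma geomD m n : geom (m + n) = geom m + 'X^m * geom n.
Proof.
rewrite /geom big_split_ord mulr_sumr /=; congr (_ + _).
by apply: eq_bigr => i _; rewrite exprD.
Qed.

Lemma geomS m : geom m.+1 = 1 + 'X * geom m.
Proof. by rewrite -add1n geomD /geom big_ord1 expr0 expr1. Qed.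

(** Subtractive Euclid on the indices: [geom n] equals [geom (n - m)] plus X^(n-m) times [geom m],
    so every step stays over the integers. *)
Lemma geom_bezout m n : exists a b, geom (gcdn m n) = a * geom m + b * geom n.
Proof.
have [k] := ubnP (m + n)%N; elim: k => // k IHk in m n *.
wlog le_mn : m n / (m <= n)%N => [hw|].
  have [/hw//|/ltnW/hw{}hw] := leqP m n.
  by rewrite addnC gcdnC => /hw[a [b ->]]; exists b, a; rewrite addrC.
have [->|m_gt0] := posnP m.
  by move=> _; exists 0, 1; rewrite gcd0n mul0r add0r mul1r.
rewrite -(subnK le_mn) ltnS => ltk.
have [|a [b E]] := IHk m (n - m)%N; first by lia.
exists (a - b * 'X^(n - m)), b; rewrite gcdnDr E geomD; ring.
Qed.

Lemma geom_dvd d m : (d %| m)%N -> exists q, geom m = q * geom d.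
Proof.
case/dvdnP=> k ->; elim: k => [|k [q E]].
  by exists 0; rewrite mul0n /geom big_ord0 mul0r.
by exists (1 + 'X^d * q); rewrite mulSn geomD E; ring.
Qed.

(** Division by the monic [g] is possible over the integers. Then [d] times the remainder is a
    multiple of [g] of smaller size than [g], hence zero. *)
Lemma monic_scale_dvd (p q g : {poly int}) (d : int) :
  g \is monic -> d != 0 -> d *: p = q * g -> exists q', p = q' * g.
Proof.
move=> g_monic nzd E; have pE := Pdiv.RingMonic.rdivp_eq g_monic p.
exists (Pdiv.CommonRing.rdivp p g); rewrite {1}pE.
have lt_rem := Pdiv.CommonRing.ltn_rmodpN0 p (monic_neq0 g_monic).
move: pE lt_rem; set u := Pdiv.CommonRing.rdivp p g.
set rem := Pdiv.CommonRing.rmodp p g => pE lt_rem.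
suff -> : rem = 0 by rewrite addr0.
have remE : d *: rem = (q - d *: u) * g.
  by rewrite mulrBl -E {1}pE scalerDr scalerAl; ring.
have [z|nz] := eqVneq (q - d *: u) 0.
  move/eqP: remE; rewrite z mul0r -mul_polyC mulf_eq0 polyC_eq0 (negPf nzd).
  by move/eqP.
have := size_Mmonic nz g_monic; rewrite -remE size_scale // => sz.
move: lt_rem; rewrite sz; have := nz; rewrite -size_poly_gt0.
by case: (size _) => // k _; rewrite addSn /= ltnNge leq_addl.
Qed.

(** * Entries of [HD] and the polynomials of its rows *)

Lemma sum_Rank (V : nmodType) n r (F : 'I_(\sum_(i < n) r) -> V) :
  \sum_s F s = \sum_(i < n) \sum_(a < r) F (@tagnat.Rank n (fun=> r) i a).
Proof.
rewrite pair_bigA /=.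
rewrite (reindex (fun p : 'I_n * 'I_r => @tagnat.Rank n (fun=> r) p.1 p.2)) //.
exists (fun s => (tagnat.sig1 s, tagnat.sig2 s)) => [[i a] _|s _] /=.
  apply/pair_eqP; rewrite /pair_eq /= tagnat.Rank1K tagnat.Rank2K cast_ord_id.
  by rewrite !eqxx.
exact: tagnat.sig2K.
Qed.

Definition HD_entry (i a j b : nat) : int :=
  if (i < j)%N then (b <= a)%:R else if (j < i)%N then - (a <= b)%:R else 0.

Lemma HD_Rank n r (s t : 'I_(\sum_(i < n) r)) :
  HD n r s t = HD_entry (tagnat.sig1 s) (tagnat.sig2 s)
                        (tagnat.sig1 t) (tagnat.sig2 t).
Proof.
rewrite /HD /mxblock mxE /HD_entry.
case: ltnP => _; first by rewrite !mxE; case: ifP => _; rewrite ?opprK ?oppr0.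
by case: ifP => _; rewrite !mxE //; case: ifP => _; rewrite ?oppr0.
Qed.

Lemma geom_filter n m : (m <= n)%N ->
  \sum_(j < n) (j < m)%:R *: 'X^j = geom m.
Proof.
move=> le_mn; rewrite /geom (big_ord_widen n (fun j => 'X^j)) //.
rewrite [RHS]big_mkcond /=.
by apply: eq_bigr => j _; case: ifP => _; rewrite ?scale1r ?scale0r.
Qed.

Lemma geom_filterC n m : (m <= n)%N ->
  \sum_(j < n) (m <= j)%:R *: 'X^j = geom n - geom m.
Proof.
move=> le_mn; rewrite -(geom_filter le_mn) -(geom_filter (leqnn n)) -sumrB.
apply: eq_bigr => j _; rewrite ltn_ord -scalerBl; congr (_ *: _).
by case: ltnP; rewrite ?subrr ?subr0.
Qed.

(** Each entry is a difference of two products, an indicator in [j] times an indicator in [b], so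
    the double sum factors into geometric sums. *)
Lemma HD_row_poly n r i a : (i <= n)%N -> (a <= r)%N ->
  \sum_(j < n.+1) \sum_(b < r.+1) HD_entry i a j b *: 'X^(j + (r - b)) =
  geom n * ('X * (geom r.+1 - geom (r - a))) - geom i * geom r.+2.
Proof.
move=> le_in le_ar.
have rows j b : HD_entry i a j b =
    (i < j)%:R * (b <= a)%:R - (j < i)%:R * (a <= b)%:R.
  by rewrite /HD_entry; case: ltngtP; rewrite ?mul1r ?mul0r ?subr0 ?sub0r.
transitivity ((\sum_(j < n.+1) (i < j)%:R *: 'X^j) *
    (\sum_(b < r.+1) (b <= a)%:R *: 'X^(r - b)) -
  (\sum_(j < n.+1) (j < i)%:R *: 'X^j) *
    (\sum_(b < r.+1) (a <= b)%:R *: 'X^(r - b)) : {poly int}).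
  rewrite !big_distrlr -sumrB; apply: eq_bigr => j _; rewrite -sumrB.
  apply: eq_bigr => b _; rewrite rows scalerBl exprD.
  by rewrite /= -!scalerAl -!scalerAr !scalerA.
rewrite geom_filterC // geom_filter ?(leqW le_in) //.
(* Reversing [b] turns the exponent [r - b] into [b]. *)
rewrite [X in _ * X - _](reindex_inj rev_ord_inj).
rewrite [X in _ - _ * X](reindex_inj rev_ord_inj) /=.
under [X in _ * X - _]eq_bigr => b _.
  rewrite (_ : (r.+1 - b.+1 <= a)%N = (r - a <= b)%N); last by lia.
  rewrite (_ : (r - (r.+1 - b.+1) = b)%N); last by have := ltn_ord b; lia.
  over.
under [X in _ - _ * X]eq_bigr => b _.
  rewrite (_ : (a <= r.+1 - b.+1)%N = (b < (r - a).+1)%N); last first.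
    by have := ltn_ord b; lia.
  rewrite (_ : (r - (r.+1 - b.+1) = b)%N); last by have := ltn_ord b; lia.
  over.
rewrite geom_filterC ?geom_filter; try lia.
(* Unfolding [geomS] on both sides exposes the identity: X times ([geom r.+1] - [geom (r - a)]),
   plus [geom (r - a).+1], is [geom r.+2]. *)
by rewrite !geomS; ring.
Qed.

(** * Closure properties of row lattices *)

Definition in_row_lattice m N (A : 'M[int]_(m, N)) (v : 'rV[int]_N) :=
  exists w, v = w *m A.

Section RowLattice.
Variables (m N : nat) (A : 'M[int]_(m, N)).
Local Notation L := (in_row_lattice A).

Lemma row_lattice0 : L 0.
Proof. by exists 0; rewrite mul0mx. Qed.

Lemma row_latticeD u v : L u -> L v -> L (u + v).
Proof. by move=> [x ->] [y ->]; exists (x + y); rewrite mulmxDl. Qed.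

Lemma row_latticeZ c v : L v -> L (c *: v).
Proof. by move=> [x ->]; exists (c *: x); rewrite scalemxAl. Qed.

Lemma row_latticeB u v : L u -> L v -> L (u - v).
Proof.
by move=> Lu /(row_latticeZ (-1)); rewrite scaleN1r; apply: row_latticeD.
Qed.

Lemma row_lattice_sum I (s : seq I) (P : pred I) (F : I -> 'rV[int]_N) :
  (forall i, P i -> L (F i)) -> L (\sum_(i <- s | P i) F i).
Proof.
by move=> LF; apply: big_ind => //; [exact: row_lattice0 | exact: row_latticeD].
Qed.

Lemma row_lattice_trans u v : L (u - v) -> L v -> L u.
Proof. by move=> Luv /(row_latticeD Luv); rewrite subrK. Qed.

Lemma row_lattice_eqv u v : L (u - v) -> L u -> L v.
Proof. by move=> Luv Lu; have := row_latticeB Lu Luv; rewrite subKr. Qed.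

End RowLattice.

(** * The row lattice of [HD] as an ideal of Z[X], truncated in degree *)

Section HDLattice.
(* Here there are [n.+1] blocks of size [r.+1], so that [n] and [r] are the
   largest indices. *)
Variables n r : nat.
Local Notation size_HD := (\sum_(i < n.+1) r.+1)%N.
Local Notation L := (in_row_lattice (HD n.+1 r.+1)).

Definition unit_row (j b : nat) : 'rV[int]_size_HD :=
  \row_t ((tagnat.sig1 t == j :> nat) && (tagnat.sig2 t == b :> nat))%:R.

Definition HD_row (i a : nat) : 'rV[int]_size_HD :=
  \row_t HD_entry i a (tagnat.sig1 t) (tagnat.sig2 t).

Lemma HD_row_lattice i a : (i <= n)%N -> (a <= r)%N -> L (HD_row i a).
Proof.
move=> le_i le_a.
exists (delta_mx 0 (@tagnat.Rank n.+1 (fun=> r.+1)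
  (Ordinal (le_i : (i < n.+1)%N)) (Ordinal (le_a : (a < r.+1)%N)))).
rewrite -rowE; apply/rowP=> t; rewrite [LHS]mxE [RHS]mxE HD_Rank.
by rewrite tagnat.Rank1K tagnat.Rank2K cast_ord_id.
Qed.

(** In a mixed second difference of four neighbouring rows all entries but two cancel. These two
    positions carry the same monomial. *)
Lemma unit_row_shift i a : (i < n)%N -> (a < r)%N ->
  L (unit_row i.+1 a.+1 - unit_row i a).
Proof.
move=> lt_i lt_a.
have -> : unit_row i.+1 a.+1 - unit_row i a =
  (HD_row i a.+1 - HD_row i.+1 a.+1) - (HD_row i a - HD_row i.+1 a).
  apply/rowP=> t; rewrite !mxE /HD_entry.
  by case: (ltngtP i (tagnat.sig1 t)); case: (ltngtP i.+1 (tagnat.sig1 t));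
    case: (ltngtP a (tagnat.sig2 t)); case: (ltngtP a.+1 (tagnat.sig2 t)) => //=;
    lia.
by apply: row_latticeB; apply: row_latticeB; apply: HD_row_lattice; lia.
Qed.

(** The corresponding monomials are X^i, ..., X^(i+r+1), so this vector represents X^i times
    [geom r.+2]. *)
Lemma unit_row_window_r i : (i < n)%N ->
  L (\sum_(b < r.+1) unit_row i b + unit_row i.+1 0).
Proof.
move=> lt_i.
have -> : \sum_(b < r.+1) unit_row i b + unit_row i.+1 0 =
  HD_row i 0 - HD_row i.+1 0.
  apply/rowP=> t; rewrite mxE summxE (bigD1 (tagnat.sig2 t)) //=.
  rewrite [X in _ + X + _]big1 => [|b].
    rewrite !mxE /HD_entry eqxx andbT addr0.
    by case: (ltngtP i (tagnat.sig1 t)); case: (ltngtP i.+1 (tagnat.sig1 t));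
      case: (ltngtP 0 (tagnat.sig2 t)) => //=; lia.
  by rewrite mxE eq_sym -val_eqE => /negPf->; rewrite andbF.
by apply: row_latticeB; apply: HD_row_lattice; lia.
Qed.

(** Represents X^(r-a) times [geom n]. As [a < r], this covers the exponents 1 to [r]; exponent 0
    comes from the last row of [HD], treated next. *)
Lemma unit_row_window_n a : (a < r)%N -> L (\sum_(j < n) unit_row j.+1 a.+1).
Proof.
move=> lt_a.
have -> : \sum_(j < n) unit_row j.+1 a.+1 = HD_row 0 a.+1 - HD_row 0 a.
  apply/rowP=> t; rewrite summxE.
  transitivity (\sum_(j < n.+1) ((0 < j)%N && (tagnat.sig1 t == j)
      && (tagnat.sig2 t == a.+1 :> nat))%:R : int).
    rewrite [RHS]big_ord_recl /= add0r; apply: eq_bigr => j _.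
    by rewrite mxE /= -val_eqE.
  rewrite (bigD1 (tagnat.sig1 t)) //= [X in _ + X]big1 => [|j nj]; last first.
    by rewrite (eq_sym _ j) (negPf nj) andbF.
  rewrite !mxE /HD_entry eqxx andbT addr0.
  by case: (posnP (tagnat.sig1 t)); case: (ltngtP (tagnat.sig2 t) a.+1) => //=;
    lia.
by apply: row_latticeB; apply: HD_row_lattice; lia.
Qed.

Lemma unit_row_window_n0 : L (\sum_(j < n) unit_row j r).
Proof.
have -> : \sum_(j < n) unit_row j r = (-1) *: HD_row n r.
  apply/rowP=> t; rewrite summxE.
  transitivity (\sum_(j < n.+1) ((j < n)%N && (tagnat.sig1 t == j)
      && (tagnat.sig2 t == r :> nat))%:R : int).
    rewrite [RHS]big_ord_recr /= ltnn addr0; apply: eq_bigr => j _.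
    by rewrite mxE /= ltn_ord -val_eqE.
  rewrite (bigD1 (tagnat.sig1 t)) //= [X in _ + X]big1 => [|j nj]; last first.
    by rewrite (eq_sym _ j) (negPf nj) andbF.
  rewrite !mxE /HD_entry eqxx andbT addr0.
  have := ltn_ord (tagnat.sig1 t); have := ltn_ord (tagnat.sig2 t).
  by case: (ltngtP (tagnat.sig1 t) n); case: (ltngtP (tagnat.sig2 t) r) => //=;
    lia.
by apply: row_latticeZ; apply: HD_row_lattice.
Qed.

(* Modulo the row lattice [unit_row j b] depends on [j + (r - b)] only; the
   representative is taken on the first block or in the first position. *)
Definition diag_row (k : nat) := unit_row (k - r) (r - k).

(** Repeated use of [unit_row_shift] lowers [j] and [b] together until one of them is 0, where the
    vector is the representative itself. *)
Lemma unit_row_diag j b : (j <= n)%N -> (b <= r)%N ->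
  L (unit_row j b - diag_row (j + (r - b))).
Proof.
elim: b j => [|b IHb] [|j] le_j le_b; rewrite /diag_row.
- rewrite subn0 add0n subnn subrr; exact: row_lattice0.
- rewrite subn0 addnK (_ : (r - (j.+1 + r) = 0)%N); last by lia.
  rewrite subrr; exact: row_lattice0.
- rewrite add0n (_ : (r - b.+1 - r = 0)%N) ?subKn //; last by lia.
  rewrite subrr; exact: row_lattice0.
have -> : (j.+1 + (r - b.+1) = j + (r - b))%N by lia.
have := row_latticeD (@unit_row_shift j b le_j le_b)
  (IHb j (ltnW le_j) (ltnW le_b)).
by rewrite addrA subrK.
Qed.

(** A section of the monomial map modulo the lattice. The largest monomial is X^(n+r), and higher
    coefficients are dropped, which is why degrees have to be controlled below. *)
Definition diag_eval (p : {poly int}) : 'rV[int]_size_HD :=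
  \sum_(k < (n + r).+1) p`_k *: diag_row k.

Lemma diag_evalD p q : diag_eval (p + q) = diag_eval p + diag_eval q.
Proof.
by rewrite -big_split; apply: eq_bigr => k _; rewrite coefD scalerDl.
Qed.

Lemma diag_eval0 : diag_eval 0 = 0.
Proof. by rewrite [LHS]big1 // => k _; rewrite coef0 scale0r. Qed.

Lemma diag_evalZ c p : diag_eval (c *: p) = c *: diag_eval p.
Proof.
by rewrite scaler_sumr; apply: eq_bigr => k _; rewrite coefZ scalerA.
Qed.

Lemma diag_eval_sum I (s : seq I) (F : I -> {poly int}) :
  diag_eval (\sum_(i <- s) F i) = \sum_(i <- s) diag_eval (F i).
Proof. exact: (big_morph _ diag_evalD diag_eval0). Qed.

Lemma diag_evalXn k : (k <= n + r)%N -> diag_eval 'X^k = diag_row k.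
Proof.
rewrite -ltnS => lt_k; rewrite [LHS](bigD1 (Ordinal lt_k)) //= [X in _ + X]big1.
  by rewrite coefXn eqxx scale1r addr0.
by move=> j; rewrite -val_eqE coefXn => /negPf->; rewrite scale0r.
Qed.

Lemma diag_eval_mul_lattice (p q : {poly int}) :
  (forall i, (i < size p)%N -> L (diag_eval ('X^i * q))) ->
  L (diag_eval (p * q)).
Proof.
move=> Lq; rewrite -[p]coefK poly_def mulr_suml diag_eval_sum.
apply: row_lattice_sum => i _.
by rewrite -scalerAl diag_evalZ; apply: row_latticeZ; apply: Lq.
Qed.

Lemma diag_eval_geom_r i : (i < n)%N -> L (diag_eval ('X^i * geom r.+2)).
Proof.
move=> lt_i; apply: row_lattice_eqv (unit_row_window_r lt_i).
rewrite /geom mulr_sumr diag_eval_sum [X in _ - X]big_ord_recr opprD addrACA /=.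
apply: row_latticeD; last first.
  rewrite -exprD diag_evalXn; last by lia.
  have := @unit_row_diag i.+1 0 lt_i (leq0n _).
  by rewrite subn0 addSnnS.
rewrite [X in X - _](reindex_inj rev_ord_inj) -sumrB.
apply: row_lattice_sum => b _ /=.
have lt_b := ltn_ord b.
rewrite -exprD diag_evalXn; last by lia.
rewrite (_ : (i + b = i + (r - (r.+1 - b.+1)))%N); last by lia.
by apply: unit_row_diag; lia.
Qed.

Lemma diag_eval_geom_n s : (s <= r)%N -> L (diag_eval ('X^s * geom n)).
Proof.
move=> le_s; rewrite /geom mulr_sumr diag_eval_sum.
case: s le_s => [|s] le_s.
  apply: row_lattice_eqv unit_row_window_n0.
  rewrite -sumrB; apply: row_lattice_sum => j _; have lt_j := ltn_ord j.
  rewrite mul1r diag_evalXn; last by lia.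
  by have := @unit_row_diag j r (ltnW lt_j) (leqnn r); rewrite subnn addn0.
have lt_a : (r - s.+1 < r)%N by lia.
apply: row_lattice_eqv (unit_row_window_n lt_a).
rewrite -sumrB; apply: row_lattice_sum => j _; have lt_j := ltn_ord j.
rewrite -exprD diag_evalXn; last by lia.
have -> : (s.+1 + j = j.+1 + (r - (r - s.+1).+1))%N by lia.
by apply: unit_row_diag; lia.
Qed.

(** The monomial map; [r] is the largest position, hence the exponent [r - b] for position [b]. *)
Definition row_poly (v : 'rV[int]_size_HD) : {poly int} :=
  \sum_t v 0 t *: 'X^(tagnat.sig1 t + (r - tagnat.sig2 t)).

Lemma row_poly_size v : (size (row_poly v) <= (n + r).+1)%N.
Proof.
apply: leq_trans (size_sum _ _ _) _; apply/bigmax_leqP=> t _.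
apply: leq_trans (size_scale_leq _ _) _; rewrite size_polyXn ltnS.
by rewrite leq_add ?leq_subr // -ltnS.
Qed.

Lemma row_polyZ c v : row_poly (c *: v) = c *: row_poly v.
Proof.
by rewrite scaler_sumr; apply: eq_bigr => t _; rewrite mxE scalerA.
Qed.

Lemma diag_eval_row_poly v : L (v - diag_eval (row_poly v)).
Proof.
rewrite {1}[v]row_sum_delta diag_eval_sum -sumrB; apply: row_lattice_sum => t _.
rewrite diag_evalZ -scalerBr; apply: row_latticeZ.
have lt1 := ltn_ord (tagnat.sig1 t); have lt2 := ltn_ord (tagnat.sig2 t).
rewrite diag_evalXn; last by lia.
have -> : delta_mx 0 t = unit_row (tagnat.sig1 t) (tagnat.sig2 t).
  apply/rowP=> u; rewrite !mxE eqxx /= -{1}[u]tagnat.sig2K -{1}[t]tagnat.sig2K.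
  by rewrite eq_Rank_const.
by apply: unit_row_diag.
Qed.

Lemma row_polyD u v : row_poly (u + v) = row_poly u + row_poly v.
Proof.
by rewrite -big_split; apply: eq_bigr => t _; rewrite mxE scalerDl.
Qed.

Lemma row_poly0 : row_poly 0 = 0.
Proof. by rewrite /row_poly big1 // => t _; rewrite mxE scale0r. Qed.

Lemma row_poly_row s :
  row_poly (row s (HD n.+1 r.+1)) =
  geom n * ('X * (geom r.+1 - geom (r - tagnat.sig2 s)))
  - geom (tagnat.sig1 s) * geom r.+2.
Proof.
have lt1 := ltn_ord (tagnat.sig1 s); have lt2 := ltn_ord (tagnat.sig2 s).
rewrite -HD_row_poly // /row_poly sum_Rank.
apply: eq_bigr => j _; apply: eq_bigr => b _.
by rewrite mxE HD_Rank tagnat.Rank1K tagnat.Rank2K cast_ord_id.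
Qed.

(** Forwards, every row maps to a combination of [geom n] and [geom r.+2], both multiples of the gcd
    polynomial. Backwards, a Bezout combination is reduced until its cofactors are small enough for
    the available windows. *)
Lemma row_poly_lattice v :
  L v <-> exists q, row_poly v = q * geom (gcdn n r.+2).
Proof.
split=> [[w ->]|[q vE]].
  have [qn En] := geom_dvd (dvdn_gcdl n r.+2).
  have [qr Er] := geom_dvd (dvdn_gcdr n r.+2).
  rewrite mulmx_sum_row (big_morph _ row_polyD row_poly0).
  apply: (big_ind (fun p => exists q, p = q * geom (gcdn n r.+2))).
  - by exists 0; rewrite mul0r.
  - by move=> _ _ [p ->] [q ->]; exists (p + q); rewrite mulrDl.
  move=> s _; rewrite row_polyZ row_poly_row.
  exists (w 0 s *: (qn * ('X * (geom r.+1 - geom (r - tagnat.sig2 s)))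
    - geom (tagnat.sig1 s) * qr)).
  by rewrite -scalerAl; congr (_ *: _); rewrite {1}En {1}Er; ring.
apply: (row_lattice_trans (diag_eval_row_poly v)).
have [a [b gE]] := geom_bezout n r.+2.
have W_monic : geom r.+2 \is monic by apply: geom_monic.
(* Only X^s with [s <= r] may multiply [geom n], so its cofactor is reduced modulo [geom r.+2] and
   the quotient is moved to the other cofactor. *)
pose b1 := Pdiv.CommonRing.rmodp (q * a) (geom r.+2).
pose c1 := q * b + Pdiv.CommonRing.rdivp (q * a) (geom r.+2) * geom n.
have fE : row_poly v = b1 * geom n + c1 * geom r.+2.
  have bE := Pdiv.RingMonic.rdivp_eq W_monic (q * a).
  by rewrite vE gE mulrDr mulrA {1}bE /c1; ring.
have size_b1 : (size b1 <= r.+1)%N.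
  rewrite -ltnS -[r.+2 in X in (_ < X)%N]size_geom.
  exact: Pdiv.CommonRing.ltn_rmodpN0 (monic_neq0 W_monic).
(* The bounds on [row_poly v] and on [b1 * geom n] limit the size of [c1 * geom r.+2]; as
   [geom r.+2] is monic, this bounds [c1]. *)
have size_c1 : (size c1 <= n)%N.
  have [->|nz] := eqVneq c1 0; first by rewrite size_poly0.
  have := size_Mmonic nz W_monic; rewrite size_geom.
  have -> : c1 * geom r.+2 = row_poly v - b1 * geom n by rewrite fE; ring.
  have : (size (row_poly v - b1 * geom n)%R <= (n + r).+1)%N.
    apply: leq_trans (size_polyD _ _) _.
    rewrite geq_max row_poly_size size_polyN.
    apply: leq_trans (size_polyMleq _ _) _; rewrite size_geom.
    by move: size_b1; lia.
  by lia.
rewrite fE diag_evalD.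
apply: row_latticeD; apply: diag_eval_mul_lattice => i lt_i.
  by apply: diag_eval_geom_n; rewrite -ltnS; apply: leq_trans lt_i _.
by apply: diag_eval_geom_r; apply: leq_trans lt_i _.
Qed.

Lemma saturated_HD : saturated (HD n.+1 r.+1).
Proof.
move=> d v w nzd dvE.
have /row_poly_lattice[q] : L (d *: v) by exists w.
rewrite row_polyZ => /monic_scale_dvd H; apply/row_poly_lattice.
(* The gcd is positive because of [r.+2], so a single block ([n = 0]) is covered as well. *)
by apply: H => //; apply: geom_monic; rewrite gcdn_gt0 orbT.
Qed.

End HDLattice.

(** * Skew-symmetry of [HD] and the conclusion *)

Lemma tr_HD n r : (HD n r)^T = - HD n r.
Proof.
apply/matrixP=> s t; rewrite [LHS]mxE [RHS]mxE !HD_Rank /HD_entry.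
by case: ltngtP; rewrite ?opprK ?oppr0.
Qed.

Theorem corollary4p8 (n r : nat) (hn : (0 < n)%N) (hr : (0 < r)%N) :
  (exists (L : 'M[int]_(\sum_(i < n) r)) (k : nat) (h : 'I_k -> int),
     is_block_diagonal_form (HD n r) L h) /\
  (forall (L : 'M[int]_(\sum_(i < n) r)) (k : nat) (h : 'I_k -> int),
     is_block_diagonal_form (HD n r) L h ->
     forall i : 'I_k,
       skew_block (h i) = skew_block 1 \/ skew_block (h i) = skew_block (-1)).
Proof.
split; first exact: skew_form_exists (tr_HD n r).
case: n hn => // n _; case: r hr => // r _ L k h LE i.
(* The units of the integers are 1 and -1. *)
have := saturated_skew_form_unit i (@saturated_HD n r) LE.
by case/orP=> /eqP->; [left | right].
Qed.
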